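(* Let $X$, $Y$ be $G$-spaces and let $f:X\rightarrow X$, $h:Y\rightarrow Y$ be pseudoequivariant, $G$-minimal maps. Then $f\times h:X\times Y\to X\times Y$ is $G\times G$-minimal if and only if for all $g,k\in G$, $x\in X$, $y\in Y$, both $(g.f(x),y)$ and $(x,k.h(y))$ belong to $\overline{(G\times G)_{f\times h}(x,y)}$.
   Context: A $G$-space $X$ is a topological space $X$ together with a topological group $G$ and a continuous action $G\times X\to X$, $(g,x)\mapsto g.x$. For $x\in X$, $G(x)=\{g.x:g\in G\}$. A map $f:X\to X$ is pseudoequivariant if it is continuous and $f(G(x))=G(f(x))$ for every $x\in X$. The $G_f$-orbit of $x$ is $G_f(x)=\{g.f^k(x):g\in G,\ k\geqslant 0\}$, where $f^k$ is the $k$-th iterate of $f$. A subset $Z\subseteq X$ is $+f$ invariant if $f(Z)\subseteq Z$, and $G$-invariant if $g.Z\subseteq Z$ for every $g\in G$. A nonempty, closed, $+f$ invariant, $G$-invariant subset $Z$ of $X$ is a $G$-minimal set of $f$ if $\overline{G_f(z)}=Z$ for every $z\in Z$. The map $f$ is $G$-minimal if $X$ itself is a $G$-minimal set of $f$ (i.e. every $G_f$-orbit is dense in $X$). The product $X\times Y$ carries the product topology and is a $G\times G$-space under $(g,k).(x,y)=(g.x,k.y)$; thus $(G\times G)_{f\times h}(x,y)=\{(g.f^n(x),k.h^n(y)):g,k\in G,\ n\geqslant 0\}$, and $G\times G$-minimality of $f\times h$ is the notion of minimality above for the group $G\times G$ acting on $X\times Y$ and the map $f\times h$. *)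

(* Defs.v *)
From HB Require Import structures.
From mathcomp Require Import all_boot.
From mathcomp Require Import all_classical topology.

Set Implicit Arguments.
Unset Strict Implicit.
Unset Printing Implicit Defensive.

Local Open Scope classical_set_scope.
Local Open Scope group_scope.

HB.mixin Record Group_isTopologicalGroup G & Topological G & Group G := {
  mulg_continuous : continuous (fun p : G * G => p.1 * p.2) ;
  invg_continuous : continuous (fun x : G => x^-1)
}.

#[short(type="topologicalGroupType")]
HB.structure Definition TopologicalGroup :=
  {G of Topological G & Group G & Group_isTopologicalGroup G}.

HB.mixin Record isGSpace (G : topologicalGroupType) X & Topological X := {
  gact : G -> X -> X ;
  gact1 : forall x, gact 1 x = x ;
  gactM : forall g k x, gact (g * k) x = gact g (gact k x) ;
  gact_continuous : continuous (fun p : G * X => gact p.1 p.2)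
}.

#[short(type="gSpaceType")]
HB.structure Definition GSpace (G : topologicalGroupType) :=
  {X of Topological X & isGSpace G X}.

Lemma continuous_pair (S T U : topologicalType) (f : S -> T) (g : S -> U) :
  continuous f -> continuous g -> continuous (fun x => (f x, g x)).
Proof. by move=> cf cg x; apply: cvg_pair; [exact: cf|exact: cg]. Qed.

Section ProductGroup.
Variables G K : topologicalGroupType.

Let mulg_pair_continuous :
  continuous (fun p : (G * K) * (G * K) => p.1 * p.2).
Proof.
pose m1 (p : (G * K) * (G * K)) := (p.1.1, p.2.1).
pose m2 (p : (G * K) * (G * K)) := (p.1.2, p.2.2).
apply: (@continuous_pair _ _ _ (fun p : (G * K) * (G * K) => p.1.1 * p.2.1)
  (fun p => p.1.2 * p.2.2)) => p.
- apply: (@continuous_comp _ _ _ m1 (fun q : G * G => q.1 * q.2));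
    last exact: mulg_continuous.
  by apply: continuous_pair => q;
    apply: continuous_comp; (exact: cvg_fst || exact: cvg_snd).
- apply: (@continuous_comp _ _ _ m2 (fun q : K * K => q.1 * q.2));
    last exact: mulg_continuous.
  by apply: continuous_pair => q;
    apply: continuous_comp; (exact: cvg_fst || exact: cvg_snd).
Qed.

Let invg_pair_continuous : continuous (fun x : G * K => x^-1).
Proof.
apply: (@continuous_pair _ _ _ (fun x : G * K => x.1^-1)
  (fun x => x.2^-1)) => x.
- by apply: (@continuous_comp _ _ _ fst (fun g : G => g^-1));
    [exact: cvg_fst|exact: invg_continuous].
- by apply: (@continuous_comp _ _ _ snd (fun g : K => g^-1));
    [exact: cvg_snd|exact: invg_continuous].
Qed.

HB.instance Definition _ := Group_isTopologicalGroup.Build (G * K)%type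
  mulg_pair_continuous invg_pair_continuous.

End ProductGroup.

Section ProductGSpace.
Variables (G K : topologicalGroupType) (X : gSpaceType G) (Y : gSpaceType K).

Definition gact_pair (g : G * K) (p : X * Y) : X * Y :=
  (gact g.1 p.1, gact g.2 p.2).

Let gact_pair1 p : gact_pair 1 p = p.
Proof. by case: p => x y; rewrite /gact_pair !gact1. Qed.

Let gact_pairM g k p : gact_pair (g * k) p = gact_pair g (gact_pair k p).
Proof. by rewrite /gact_pair !gactM. Qed.

Let gact_pair_continuous :
  continuous (fun p : (G * K) * (X * Y) => gact_pair p.1 p.2).
Proof.
pose m1 (p : (G * K) * (X * Y)) := (p.1.1, p.2.1).
pose m2 (p : (G * K) * (X * Y)) := (p.1.2, p.2.2).
apply: (@continuous_pair _ _ _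
  (fun p : (G * K) * (X * Y) => gact p.1.1 p.2.1)
  (fun p => gact p.1.2 p.2.2)) => p.
- apply: (@continuous_comp _ _ _ m1 (fun q : G * X => gact q.1 q.2));
    last exact: gact_continuous.
  by apply: continuous_pair => q;
    apply: continuous_comp; (exact: cvg_fst || exact: cvg_snd).
- apply: (@continuous_comp _ _ _ m2 (fun q : K * Y => gact q.1 q.2));
    last exact: gact_continuous.
  by apply: continuous_pair => q;
    apply: continuous_comp; (exact: cvg_fst || exact: cvg_snd).
Qed.

HB.instance Definition _ := isGSpace.Build (G * K)%type (X * Y)%type
  gact_pair1 gact_pairM gact_pair_continuous.

End ProductGSpace.

Section Dynamics.
Variables (G : topologicalGroupType) (X : gSpaceType G).
Implicit Types (f : X -> X) (x : X) (Z : set X).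

Definition gorbit x : set X := [set gact g x | g in [set: G]].

Definition pseudoequivariant f :=
  continuous f /\ forall x, f @` gorbit x = gorbit (f x).

Definition gforbit f x : set X :=
  [set y | exists (g : G) (n : nat), y = gact g (iter n f x)].

Definition finvariant f Z := f @` Z `<=` Z.

Definition ginvariant Z := forall g : G, gact g @` Z `<=` Z.

Definition gminimal_set f Z :=
  [/\ Z !=set0, closed Z, finvariant f Z, ginvariant Z &
      forall z, Z z -> closure (gforbit f z) = Z].

Definition gminimal f := gminimal_set f [set: X].

End Dynamics.

Arguments gorbit G {X} x.
Arguments pseudoequivariant G {X} f.
Arguments gforbit G {X} f x.
Arguments ginvariant G {X} Z.
Arguments gminimal_set G {X} f Z.
Arguments gminimal G {X} f.

Definition prod_map (X Y : Type) (f : X -> X) (h : Y -> Y) (p : X * Y) :=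
  (f p.1, h p.2).

(* Main.v *)
Require Import Defs.
From mathcomp Require Import all_boot all_classical topology.

Local Open Scope classical_set_scope.

(** Orbit closures of a pseudoequivariant map are invariant under the map and
    the group, so orbit closures are nested: [q] in the orbit closure of [p]
    forces the orbit closure of [q] inside that of [p].  Iterating
    [(f x, y)] in the closure of the orbit of [(x, y)] thus puts the whole
    [G_f]-orbit of [x], times [y], in that closure; by density of this orbit the
    closure contains the horizontal slice [X * {y}], and likewise each vertical
    slice through a point of it. *)

(** The preimage of [C] under [phi] is closed and contains [D], hence its closure. This reduces
    claims about all limit points to claims about orbit points. *)
Lemma closure_image_closed (S T : topologicalType) (phi : S -> T)
    (D : set S) (C : set T) :
  continuous phi -> closed C -> (forall x, D x -> C (phi x)) ->
  forall x, closure D x -> C (phi x).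
Proof.
move=> cphi clC DC x clx; apply: clC => B /cphi nB.
by have [z [Dz Bz]] := clx _ nB; exists (phi z); split=> //; apply: DC.
Qed.

Lemma closure_stable (T : topologicalType) (phi : T -> T) (A : set T) :
  continuous phi -> (forall x, A x -> A (phi x)) ->
  forall x, closure A x -> closure A (phi x).
Proof.
move=> cphi Aphi; apply: closure_image_closed cphi _ _.
  exact: closed_closure.
by move=> x Ax; apply/subset_closure/Aphi.
Qed.

Section OrbitClosure.
Context {G : topologicalGroupType} {X : gSpaceType G} {f : X -> X}.

Lemma gact_continuousr (g : G) : continuous (gact g : X -> X).
Proof.
move=> x; apply: (@continuous_comp _ _ _ (fun x : X => (g, x))
  (fun p : G * X => gact p.1 p.2)); last exact: gact_continuous.
by apply: continuous_pair => z; [exact: cvg_cst|exact: cvg_id].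
Qed.

Lemma gforbit_refl x : gforbit G f x x.
Proof. by exists 1%g, 0; rewrite gact1. Qed.

Lemma gforbit_gact x (g : G) y :
  gforbit G f x y -> gforbit G f x (gact g y).
Proof. by move=> [k [n ->]]; exists (g * k)%g, n; rewrite gactM. Qed.

Lemma closure_gforbit_gact x (g : G) y :
  closure (gforbit G f x) y -> closure (gforbit G f x) (gact g y).
Proof. exact: closure_stable (gact_continuousr g) (gforbit_gact x g) _. Qed.

Hypothesis pf : pseudoequivariant G f.

(** Pseudoequivariance lets [f] pass a group element at the price of changing it:
    [f (g.z) = k.(f z)] for some [k]. *)
Lemma gforbit_map x y : gforbit G f x y -> gforbit G f x (f y).
Proof.
move=> [g [n ->]].
have : gorbit G (f (iter n f x)) (f (gact g (iter n f x))).
  by rewrite -(proj2 pf); exists (gact g (iter n f x)) => //; exists g.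
by move=> [k _ <-]; exists k, n.+1.
Qed.

Lemma closure_gforbit_trans x y z :
  closure (gforbit G f x) y -> closure (gforbit G f y) z ->
  closure (gforbit G f x) z.
Proof.
(* With the identity as map, it suffices that the closed set contains the orbit of [y] itself. *)
move=> xy; apply: (@closure_image_closed _ _ id); [by move=> ?|exact: closed_closure|].
move=> _ [g [n ->]].
apply: closure_gforbit_gact.
elim: n => //= n IHn.
exact: closure_stable (proj1 pf) (gforbit_map x) _ IHn.
Qed.

End OrbitClosure.

(** An orbit of the product group is the product of the two orbits, so group elements found
    separately in each coordinate pair up into a witness. *)
Lemma pseudoequivariant_prod {G K : topologicalGroupType}
    {X : gSpaceType G} {Y : gSpaceType K} {f : X -> X} {h : Y -> Y} :
  pseudoequivariant G f -> pseudoequivariant K h ->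
  pseudoequivariant (G * K)%type (prod_map f h).
Proof.
move=> [cf ef] [ch eh]; split.
  apply: (@continuous_pair _ _ _ (fun p : X * Y => f p.1) (fun p => h p.2)) => p.
  - by apply: (@continuous_comp _ _ _ fst f); [exact: cvg_fst|exact: cf].
  - by apply: (@continuous_comp _ _ _ snd h); [exact: cvg_snd|exact: ch].
move=> [x y]; apply/seteqP; split.
  move=> _ [_ [[g k] _ <-] <-].
  have : gorbit G (f x) (f (gact g x)).
    by rewrite -ef; exists (gact g x) => //; exists g.
  have : gorbit K (h y) (h (gact k y)).
    by rewrite -eh; exists (gact k y) => //; exists k.
  by move=> [k' _ ek] [g' _ eg]; exists (g', k') => //; congr pair.
move=> _ [[g k] _ <-].
have : (f @` gorbit G x) (gact g (f x)) by rewrite ef; exists g.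
have : (h @` gorbit K y) (gact k (h y)) by rewrite eh; exists k.
move=> [_ [k' _ <-] ek] [_ [g' _ <-] eg].
exists (gact g' x, gact k' y); first by exists (g', k').
by congr pair.
Qed.

Theorem proposition3p5 (G : topologicalGroupType) (X Y : gSpaceType G)
    (f : X -> X) (h : Y -> Y)
    (pf : pseudoequivariant G f) (ph : pseudoequivariant G h)
    (mf : gminimal G f) (mh : gminimal G h) :
  gminimal (G * G)%type (prod_map f h) <->
  (forall (g k : G) (x : X) (y : Y),
     closure (gforbit (G * G)%type (prod_map f h) (x, y)) (gact g (f x), y) /\
     closure (gforbit (G * G)%type (prod_map f h) (x, y)) (x, gact k (h y))).
Proof.
split=> [[_ _ _ _ dense] g k x y|cl]; first by rewrite dense.
have [[x0 _] _ _ _ densef] := mf.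
have [[y0 _] _ _ _ denseh] := mh.
have pfh := pseudoequivariant_prod pf ph.
have stepX x y :
    closure (gforbit (G * G)%type (prod_map f h) (x, y)) (f x, y).
  by have [+ _] := cl 1%g 1%g x y; rewrite gact1.
have stepY x y :
    closure (gforbit (G * G)%type (prod_map f h) (x, y)) (x, h y).
  by have [_] := cl 1%g 1%g x y; rewrite gact1.
have sliceX x x' y :
    closure (gforbit (G * G)%type (prod_map f h) (x, y)) (x', y).
  (* By minimality of [f], [x'] is a limit of points [g.f^n(x)]; only these need be placed in the
     slice at [y]. *)
  apply: (@closure_image_closed _ _ (fun z : X => (z, y)) (gforbit G f x));
    [|exact: closed_closure| |by rewrite densef].
    by apply: continuous_pair => z; [exact: cvg_id|exact: cvg_cst].
  move=> _ [g [n ->]].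
  (* Acting by [(g, 1)] moves the first coordinate alone, so invariance of the closure strips off
     [g]. *)
  have -> : (gact g (iter n f x), y) =
      gact ((g, 1%g) : (G * G)%type) (iter n f x, y).
    by congr pair; rewrite /= gact1.
  apply: closure_gforbit_gact.
  elim: n => [|n IHn] /=; first exact/subset_closure/gforbit_refl.
  (* The hypothesis is applied at the moved point [(f^n(x), y)], and nesting of closures brings the
     result back to [(x, y)]. *)
  exact: (closure_gforbit_trans pfh) IHn (stepX _ _).
have sliceY x y y' :
    closure (gforbit (G * G)%type (prod_map f h) (x, y)) (x, y').
  apply: (@closure_image_closed _ _ (fun z : Y => (x, z)) (gforbit G h y));
    [|exact: closed_closure| |by rewrite denseh].
    by apply: continuous_pair => z; [exact: cvg_cst|exact: cvg_id].
  move=> _ [g [n ->]].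
  have -> : (x, gact g (iter n h y)) =
      gact ((1%g, g) : (G * G)%type) (x, iter n h y).
    by congr pair; rewrite /= gact1.
  apply: closure_gforbit_gact.
  elim: n => [|n IHn] /=; first exact/subset_closure/gforbit_refl.
  exact: (closure_gforbit_trans pfh) IHn (stepY _ _).
split; [by exists (x0, y0)|exact: closedT|by []|by []|].
move=> [x y] _; apply/seteqP; split=> // -[x' y'] _.
(* The corner [(x', y)] links the horizontal slice through [(x, y)] to the vertical slice containing
   [(x', y')]. *)
exact: (closure_gforbit_trans pfh) (sliceX x x' y) (sliceY x' y y').
Qed.
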